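(* Let each $f_i:\mathbb{R}^d\to\mathbb{R}$ ($i=1,\dots,m$) be $\mu$-strongly convex and $L$-smooth, and let $G:\mathbb{R}^d\to\mathbb{R}\cup\{\pm\infty\}$ be proper, closed and convex. Let $x^\star\in\mathbb{R}^d$ be the optimal solution of $$\min_{x\in\mathbb{R}^d}\ \frac1m\sum_{i=1}^m f_i(x)+G(x).$$ Let $A\in\mathbb{R}^{m\times m}$, $B\in\mathbb{S}^m$, $C\in\mathbb{S}^m_+$ satisfy all of the following: (a) $\mathrm{null}(C)=\mathrm{span}(1)$; (b) $1^\top A\,1=m$ and $1^\top B=1^\top$; (c) $A=BD$ for some $D\in\mathbb{S}^m$ with $-I\prec D\preceq I$; (d) $0\prec I-C$; (e) $B$ and $C$ commute; (f) $B^2\prec \dfrac{(L+\mu)^2}{\left(L\lambda_{\max}(D)-\mu\lambda_{\min}(D)\right)^2}\,(I-C)$. Let $\{(X^k,Z^k,Y^k)\}_{k\ge 0}$ be generated by $$X^k=\mathrm{prox}_{\gamma g}(Z^k),\qquad Z^{k+1}=AX^k-\gamma B\nabla f(X^k)-Y^k,\qquad Y^{k+1}=Y^k+CZ^{k+1},$$ from any $Z^0\in\mathbb{R}^{m\times d}$ and any $Y^0\in\mathbb{R}^{m\times d}$ whose columns lie in the range of $C$, with step-size $\gamma>0$ satisfying $$\frac1\mu\left(\lambda_{\max}(D)-\lambda_{\max}\!\left(B^2(I-C)^{-1}\right)^{-1/2}\right)_+<\gamma<\frac1L\left(\lambda_{\min}(D)+\lambda_{\max}\!\left(B^2(I-C)^{-1}\right)^{-1/2}\right).$$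 Then $\|X^k-1x^{\star\top}\|^2=\mathcal{O}(\lambda^k)$, where $$\lambda\triangleq\max\left(q^2\lambda_{\max}\!\left(B^2(I-C)^{-1}\right),\ 1-\lambda_2(C)\right)<1,$$ $$q\triangleq\max\left(|\lambda_{\min}(D)-\gamma L|,\ |\lambda_{\max}(D)-\gamma\mu|\right).$$ Moreover, the optimal step-size is $\gamma^\star\triangleq\frac{\lambda_{\max}(D)+\lambda_{\min}(D)}{L+\mu}$: it yields the smallest value of $q$, namely $q^\star\triangleq\frac{L\lambda_{\max}(D)-\mu\lambda_{\min}(D)}{L+\mu}$, and thus the optimal (smallest) rate $\lambda$.
   Context: $m$ is the number of agents and $0<\mu\le L$; $L$-smooth means differentiable with $L$-Lipschitz gradient. $\mathbb{S}^m$ is the set of real symmetric $m\times m$ matrices, $\mathbb{S}^m_+$ the positive semidefinite ones; $\prec,\preceq$ denote the Loewner order. $1\in\mathbb{R}^m$ is the all-ones column vector and $I$ the identity. Eigenvalues of a symmetric matrix are arranged in increasing order $\lambda_1\le\lambda_2\le\dots\le\lambda_m$, and $\lambda_{\min},\lambda_{\max}$ denote the smallest and largest. $x_+=\max(x,0)$. $\|\cdot\|$ is the Frobenius norm on $\mathbb{R}^{m\times d}$. For $X=[x_1,\dots,x_m]^\top\in\mathbb{R}^{m\times d}$ (row $i$ is $x_i^\top$ with $x_i\in\mathbb{R}^d$), set $f(X)=\sum_{i=1}^m f_i(x_i)$, $g(X)=\sum_{i=1}^m G(x_i)$, and $\nabla f(X)=[\nabla f_1(x_1),\dots,\nabla f_m(x_m)]^\top\in\mathbb{R}^{m\times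 d}$. The proximal operator is $\mathrm{prox}_{\gamma g}(Z)=\arg\min_{Y\in\mathbb{R}^{m\times d}}\ g(Y)+\frac{1}{2\gamma}\|Z-Y\|^2$. *)

(* Defs.v *)
(* R^d is 'rV[R]_d, so that row i of X is x_i^T. *)
From HB Require Import structures.
From mathcomp Require Import all_boot all_order all_algebra.
From mathcomp Require Import all_classical all_reals all_analysis.
Set Implicit Arguments.
Unset Strict Implicit.
Unset Printing Implicit Defensive.
Import Order.TTheory GRing.Theory Num.Theory.
Import numFieldNormedType.Exports.
Local Open Scope classical_set_scope.
Local Open Scope ring_scope.

Section Matrices.
Context {R : realType}.

(* Frobenius norm (Euclidean norm on 'rV[R]_d); the library norm `|X| on
   matrices is the max norm. *)
Definition frob m d (X : 'M[R]_(m, d)) : R :=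
  Num.sqrt (\sum_i \sum_j X i j ^+ 2).

Definition ones m : 'cV[R]_m := const_mx 1.

Definition loewner_le m (P Q : 'M[R]_m) : Prop :=
  Q - P \is symmetricmx /\
  forall v : 'cV[R]_m, 0 <= (v^T *m (Q - P) *m v) 0 0.

Definition loewner_lt m (P Q : 'M[R]_m) : Prop :=
  Q - P \is symmetricmx /\
  forall v : 'cV[R]_m, v != 0 -> 0 < (v^T *m (Q - P) *m v) 0 0.

(* The nondecreasing list of eigenvalues, repeated according to multiplicity.
   It is unique when it exists, and it exists for symmetric P; otherwise the
   value is the junk [::]. *)
Definition eigenvalues m (P : 'M[R]_m) : seq R :=
  xget [::] [set s | sorted <=%R s /\ char_poly P = \prod_(a <- s) ('X - a%:P)].

(* lambda_k, numbered from 1 *)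
Definition eigval k m (P : 'M[R]_m) : R := nth 0 (eigenvalues P) k.-1.

Definition lambda_min m (P : 'M[R]_m) : R := eigval 1 P.
Definition lambda_max m (P : 'M[R]_m) : R := eigval m P.

End Matrices.

Section Functions.
Context {R : realType}.

Definition argmin (T : Type) (F : T -> \bar R) : set T :=
  [set x | forall y, (F x <= F y)%E].

Definition grad d (f : 'rV[R]_d -> R) (x : 'rV[R]_d) : 'rV[R]_d :=
  \row_j 'D_(delta_mx 0 j) f x.

Definition strongly_convex d (mu : R) (f : 'rV[R]_d -> R) : Prop :=
  forall (x y : 'rV[R]_d) (t : R), 0 <= t <= 1 ->
    f (t *: x + (1 - t) *: y) <=
      t * f x + (1 - t) * f y - mu / 2 * t * (1 - t) * frob (x - y) ^+ 2.

Definition smooth d (L : R) (f : 'rV[R]_d -> R) : Prop :=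
  (forall x, differentiable f x) /\
  forall x y, frob (grad f x - grad f y) <= L * frob (x - y).

Definition proper_fun d (G : 'rV[R]_d -> \bar R) : Prop :=
  (forall x, G x != -oo%E) /\ exists x, G x != +oo%E.

Definition closed_fun d (G : 'rV[R]_d -> \bar R) : Prop :=
  closed [set p : 'rV[R]_d * R | (G p.1 <= p.2%:E)%E].

(* Only used for functions avoiding -oo, for which no +oo - oo occurs;
   0 * +oo = 0 in \bar R. *)
Definition convex_fun d (G : 'rV[R]_d -> \bar R) : Prop :=
  forall (x y : 'rV[R]_d) (t : R), 0 <= t <= 1 ->
    (G (t *: x + (1 - t) *: y)%R <= t%:E * G x + (1 - t)%:E * G y)%E.

(* The set of minimizers; X = prox_(gamma g)(Z) is rendered as
   [prox gamma g Z X]. *)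
Definition prox m d (gamma : R) (g : 'M[R]_(m, d) -> \bar R) (Z : 'M[R]_(m, d))
    : set 'M[R]_(m, d) :=
  argmin (fun Y => g Y + ((2 * gamma)^-1 * frob (Z - Y) ^+ 2)%:E)%E.

Definition sum_rows m d (G : 'rV[R]_d -> \bar R) (X : 'M[R]_(m, d)) : \bar R :=
  (\sum_(i < m) G (row i X))%E.

Definition grad_rows m d (f : 'I_m -> 'rV[R]_d -> R) (X : 'M[R]_(m, d))
    : 'M[R]_(m, d) :=
  \matrix_(i < m) grad (f i) (row i X).

End Functions.

Section Algorithm.
Context {R : realType} (m d : nat).
Implicit Types (mu L gamma : R) (A B C D : 'M[R]_m).

Definition abc_iterates A B C gamma (f : 'I_m -> 'rV[R]_d -> R)
    (G : 'rV[R]_d -> \bar R) (X Z Y : nat -> 'M[R]_(m, d)) : Prop :=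
  [/\ forall j, exists v : 'cV[R]_m, col j (Y 0) = C *m v,
      forall k, prox gamma (sum_rows G) (Z k) (X k),
      forall k, Z k.+1 =
        A *m X k - gamma *: (B *m grad_rows f (X k)) - Y k &
      forall k, Y k.+1 = Y k + C *m Z k.+1].

Definition lambda_BC B C : R := lambda_max (B *m B *m invmx (1%:M - C)).

Definition admissible_step mu L B C D gamma : Prop :=
  0 < gamma /\
  mu^-1 * Num.max (lambda_max D - (Num.sqrt (lambda_BC B C))^-1) 0
    < gamma < L^-1 * (lambda_min D + (Num.sqrt (lambda_BC B C))^-1).

Definition qfactor mu L D gamma : R :=
  Num.max `|lambda_min D - gamma * L| `|lambda_max D - gamma * mu|.

Definition rate mu L B C D gamma : R :=
  Num.max (qfactor mu L D gamma ^+ 2 * lambda_BC B C) (1 - eigval 2 C).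

Definition gamma_star mu L D : R := (lambda_max D + lambda_min D) / (L + mu).

Definition q_star mu L D : R :=
  (L * lambda_max D - mu * lambda_min D) / (L + mu).

(* When L * lambda_max D = mu * lambda_min D (which forces L = mu and D = I)
   the coefficient is +oo and no constraint is imposed; MathComp's x / 0 = 0
   would instead make the condition unsatisfiable. *)
Definition coupling_condition mu L B C D : Prop :=
  L * lambda_max D - mu * lambda_min D != 0 ->
  loewner_lt (B *m B)
    (((L + mu) ^+ 2 / (L * lambda_max D - mu * lambda_min D) ^+ 2)
       *: (1%:M - C)).

End Algorithm.

(* Main.v *)
(* Write z, x, w for the deviations of Z^k, X^k and of a primal w with
   Y^k - Y^* = C w from the fixed point, put u = D x - gamma (grad f(X^k) -
   grad f(X^* )), and let M = (I - C)^-1.  Then z+ = B u - C w, w+ = w + z+, and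
   the cross terms cancel in
     |z+|^2 + <w+, C M w+> = <B u, M B u> + <w, C w>,
   whose right-hand side is at most lambda_max(B^2 M) |u|^2 plus
   (1 - lambda_2(C)) <w, C M w>.  Cocoercivity says that the increment of the
   gradient is (L + mu)/2 x up to an error of norm (L - mu)/2 |x|, so
   |u| <= q |x|, and the proximal operator is nonexpansive, so |x| <= |z|.  The
   Lyapunov function |z|^2 + <w, C M w> thus contracts by the factor lambda. *)
Require Import Defs.
From mathcomp Require Import all_boot all_order all_algebra.
From mathcomp Require Import all_classical all_reals all_analysis.
From mathcomp Require Import perm spectral.
From mathcomp Require Import complex.
From mathcomp Require Import ring lra.
Import Order.TTheory GRing.Theory Num.Theory.
Import numFieldNormedType.Exports.
Local Open Scope classical_set_scope.
Local Open Scope ring_scope.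
Set Implicit Arguments.
Unset Strict Implicit.
Unset Printing Implicit Defensive.

(** * Frobenius inner product and the real spectral theorem *)

Section Spectral.
Context {R : realType}.

(** The hypotheses hide two facts. By (b) and (c), 1^T D 1 = 1^T A 1 = m, so D <= I is tight at 1;
    this forces D 1 = 1 and lambda_max(D) = 1, hence B D fixes the consensual point. Optimality of
    [xstar] makes the columns of Y^* sum to zero, so Y^* lies in the range of C and the primal w
    exists. The obstacle in |u| <= q |x| is that D and the gradient increment share no eigenbasis;
    comparing each with a multiple of x decouples them at no loss. The step-size window says q <
    lambda_max(B^2 M)^(-1/2), and (f), when its coefficient is finite, says the same of q^*. *)

Definition dot m d (X Y : 'M[R]_(m, d)) : R := \sum_i \sum_j X i j * Y i j.

Lemma dotE m d (X Y : 'M[R]_(m, d)) : dot X Y = \sum_i \sum_j X i j * Y i j.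
Proof. by []. Qed.

Lemma dot_trace m d (X Y : 'M[R]_(m, d)) : dot X Y = \tr (X^T *m Y).
Proof.
rewrite /dot /mxtrace exchange_big /=; apply: eq_bigr => j _.
by rewrite mxE; apply: eq_bigr => i _; rewrite mxE.
Qed.

Lemma dotC m d (X Y : 'M[R]_(m, d)) : dot X Y = dot Y X.
Proof. by rewrite !dot_trace -mxtrace_tr trmx_mul trmxK. Qed.

Lemma dotDl m d (X Y Z : 'M[R]_(m, d)) : dot (X + Y) Z = dot X Z + dot Y Z.
Proof. by rewrite !dot_trace linearD mulmxDl linearD. Qed.

Lemma dotDr m d (X Y Z : 'M[R]_(m, d)) : dot Z (X + Y) = dot Z X + dot Z Y.
Proof. by rewrite !(dotC Z) dotDl. Qed.

Lemma dotZl m d a (X Z : 'M[R]_(m, d)) : dot (a *: X) Z = a * dot X Z.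
Proof. by rewrite !dot_trace linearZ /= -scalemxAl linearZ. Qed.

Lemma dotZr m d a (X Z : 'M[R]_(m, d)) : dot Z (a *: X) = a * dot Z X.
Proof. by rewrite !(dotC Z) dotZl. Qed.

Lemma dotNl m d (X Z : 'M[R]_(m, d)) : dot (- X) Z = - dot X Z.
Proof. by rewrite -scaleN1r dotZl mulN1r. Qed.

Lemma dotNr m d (X Z : 'M[R]_(m, d)) : dot Z (- X) = - dot Z X.
Proof. by rewrite !(dotC Z) dotNl. Qed.

Lemma dotBl m d (X Y Z : 'M[R]_(m, d)) : dot (X - Y) Z = dot X Z - dot Y Z.
Proof. by rewrite dotDl dotNl. Qed.

Lemma dotBr m d (X Y Z : 'M[R]_(m, d)) : dot Z (X - Y) = dot Z X - dot Z Y.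
Proof. by rewrite dotDr dotNr. Qed.

Definition dot_lin := (dotDl, dotDr, dotNl, dotNr, dotZl, dotZr).

Lemma dot0l m d (X : 'M[R]_(m, d)) : dot 0 X = 0.
Proof. by rewrite -(scale0r 0) dotZl mul0r. Qed.

Lemma dot_mulmx m n d (P : 'M[R]_(m, n)) (X : 'M[R]_(n, d)) (Y : 'M[R]_(m, d)) :
  dot (P *m X) Y = dot X (P^T *m Y).
Proof. by rewrite !dot_trace trmx_mul mulmxA. Qed.

Lemma dot_ge0 m d (X : 'M[R]_(m, d)) : 0 <= dot X X.
Proof.
rewrite dotE; apply: sumr_ge0 => i _; apply: sumr_ge0 => j _.
by rewrite -expr2 sqr_ge0.
Qed.

Lemma dot_eq0 m d (X : 'M[R]_(m, d)) : dot X X = 0 -> X = 0.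
Proof.
rewrite dotE => /eqP; rewrite psumr_eq0; last first.
  by move=> i _; apply: sumr_ge0 => j _; rewrite -expr2 sqr_ge0.
move=> /allP X0; apply/matrixP => i j; rewrite mxE.
have /implyP/(_ isT) := X0 i (mem_index_enum _).
rewrite psumr_eq0; last by move=> k _; rewrite -expr2 sqr_ge0.
by move=> /allP/(_ j (mem_index_enum _))/implyP/(_ isT); rewrite mulf_eq0 orbb => /eqP.
Qed.

Lemma dot_gt0 m d (X : 'M[R]_(m, d)) : X != 0 -> 0 < dot X X.
Proof.
move=> X0; rewrite lt0r dot_ge0 andbT; apply: contra_neq X0; exact: dot_eq0.
Qed.

Lemma frob_ge0 m d (X : 'M[R]_(m, d)) : 0 <= frob X.
Proof. exact: sqrtr_ge0. Qed.

Lemma frob_sqr m d (X : 'M[R]_(m, d)) : frob X ^+ 2 = dot X X.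
Proof.
by rewrite /frob sqr_sqrtr -?dotE ?dot_ge0.
Qed.

Lemma frobN m d (X : 'M[R]_(m, d)) : frob (- X) = frob X.
Proof.
by apply/eqP; rewrite -(eqrXn2 (n:=2))// ?frob_ge0// !frob_sqr dotNl dotNr opprK.
Qed.

Lemma cauchy_schwarz m d (X Y : 'M[R]_(m, d)) : dot X Y <= frob X * frob Y.
Proof.
have [->|Y0] := eqVneq Y 0; first by rewrite dotC dot0l mulr_ge0 ?frob_ge0.
have Ygt := dot_gt0 Y0.
have [|n] := leP (dot X Y) 0.
  by move/le_trans; apply; rewrite mulr_ge0 ?frob_ge0.
rewrite -(ler_pXn2r (n:=2)) ?nnegrE// ?mulr_ge0 ?frob_ge0 ?(ltW n)//.
rewrite exprMn !frob_sqr.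
(* This is [dot Y Y] times the component of [X] orthogonal to [Y]; the scaling avoids a division. *)
have := dot_ge0 (dot Y Y *: X - dot X Y *: Y).
rewrite !dot_lin (dotC Y X) => h.
have : 0 <= dot Y Y * (dot X X * dot Y Y - dot X Y ^+ 2) by lra.
by rewrite pmulr_rge0// subr_ge0.
Qed.

Lemma frob_triangle m d (X Y : 'M[R]_(m, d)) : frob (X + Y) <= frob X + frob Y.
Proof.
rewrite -(ler_pXn2r (n:=2)) ?nnegrE// ?addr_ge0 ?frob_ge0//.
have := cauchy_schwarz X Y.
rewrite sqrrD !frob_sqr !dot_lin (dotC Y X); lra.
Qed.

Lemma frobZ m d a (X : 'M[R]_(m, d)) : 0 <= a -> frob (a *: X) = a * frob X.
Proof.
move=> a0; apply/eqP; rewrite -(eqrXn2 (n:=2)) ?frob_ge0 ?mulr_ge0 ?frob_ge0//.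
by rewrite exprMn !frob_sqr !dot_lin mulrA.
Qed.

Lemma dot_rows m d (X Y : 'M[R]_(m, d)) :
  dot X Y = \sum_i dot (row i X) (row i Y).
Proof.
rewrite dotE; apply: eq_bigr => i _; rewrite dotE big_ord1.
by apply: eq_bigr => j _; rewrite !mxE.
Qed.

Lemma dot_cols m d (X Y : 'M[R]_(m, d)) :
  dot X Y = \sum_j dot (col j X) (col j Y).
Proof.
rewrite dotE exchange_big /=; apply: eq_bigr => j _; rewrite dotE.
by apply: eq_bigr => i _; rewrite big_ord1 !mxE.
Qed.

Lemma quadE m (P : 'M[R]_m) (v : 'cV[R]_m) :
  (v^T *m P *m v) 0 0 = dot v (P *m v).
Proof. by rewrite -mulmxA dot_trace /mxtrace big_ord1. Qed.

Lemma symmetricmx_trP m (P : 'M[R]_m) : P \is symmetricmx <-> P^T = P.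
Proof.
split=> [/is_hermitianmxP {2}->|e]; last apply/is_hermitianmxP;
  by rewrite expr0 scale1r map_mx_id ?e.
Qed.

(** The complexified matrix is Hermitian, so its spectrum is real. A real root of the complex
    characteristic polynomial is a root of the real one, which yields a real eigenvector. *)
Lemma sym_real_eigenvector n (P : 'M[R]_n.+1) : P^T = P ->
  exists a (v : 'cV[R]_n.+1), dot v v = 1 /\ P *m v = a *: v.
Proof.
move=> sP.
pose Q : 'M[R[i]]_n.+1 := map_mx (real_complex R) P.
have Qh : Q \is hermsymmx.
  apply: realsym_hermsym.
    by apply/is_hermitianmxP; rewrite expr0 scale1r map_mx_id// map_trmx sP.
  by apply/mxOverP => i j; rewrite mxE; apply/complex_realP; exists (P i j).
have /orthomx_spectralP Qe := hermitian_normalmx Qh.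
have /mxOverP/(_ 0 0)/complex_realP[a sp0] := hermitian_spectral_diag_real Qh.
set S := spectralmx Q in Qe; have Su : S \in unitmx := spectral_unit Q.
have : eigenvalue P a.
  rewrite eigenvalue_root_char -(fmorph_root (real_complex R)) map_char_poly.
  rewrite -eigenvalue_root_char; apply/eigenvalueP; exists (row 0 S).
    have -> : map_mx (real_complex R) P = Q by [].
    rewrite {1}Qe -row_mul -!mulmxA (mulmxA S) mulmxV// mul1mx.
    by rewrite mul_diag_mx; apply/rowP => j; rewrite !mxE sp0.
  apply/negP => /eqP r0; move: Su; rewrite -row_free_unit => /row_freeP[T ST].
  have := congr1 (row 0) ST; rewrite row_mul r0 mul0mx => /rowP/(_ 0).
  by rewrite !mxE eqxx => /esym/eqP; rewrite oner_eq0.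
move=> /eigenvalueP[v vP v0].
have v0' : v^T != 0 by rewrite trmx_eq0.
have fv : 0 < frob v^T.
  by rewrite lt0r frob_ge0 andbT -sqrf_eq0 frob_sqr gt_eqF ?dot_gt0.
exists a, ((frob v^T)^-1 *: v^T); split.
  by rewrite !dot_lin -frob_sqr mulrA -expr2 exprVn mulVf// sqrf_eq0 gt_eqF.
by rewrite -scalemxAr -{1}sP -trmx_mul vP linearZ /= !scalerA mulrC.
Qed.

(** The reflection across the hyperplane orthogonal to [v - e] swaps the two unit vectors. It
    provides an orthogonal change of basis with a prescribed first vector. *)
Lemma householder n (v e : 'cV[R]_n) : dot v v = 1 -> dot e e = 1 ->
  exists H : 'M[R]_n, [/\ H^T = H, H *m H = 1%:M & H *m v = e].
Proof.
move=> v1 e1; have [->|ve] := eqVneq v e.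
  by exists 1%:M; rewrite trmx1 !mul1mx.
pose w := v - e; have w0 : 0 < dot w w by rewrite dot_gt0// subr_eq0.
have dotM (x y : 'cV[R]_n) : x^T *m y = (dot x y)%:M.
  by rewrite dot_trace /mxtrace big_ord1; exact: mx11_scalar.
pose c := 2 / dot w w.
exists (1%:M - c *: (w *m w^T)); split.
- by rewrite linearB /= linearZ /= trmx1 trmx_mul trmxK.
- rewrite mulmxBl mul1mx mulmxBr mulmx1 -scalemxAl -scalemxAr.
  rewrite -[w *m w^T *m _]mulmxA [w^T *m _]mulmxA dotM mul_scalar_mx -scalemxAr.
  rewrite !scalerA.
  have -> : c * (c * dot w w) = c + c by rewrite /c; field; rewrite gt_eqF.
  by rewrite scalerDl opprB addrK subrK.
- rewrite mulmxBl mul1mx -scalemxAl -mulmxA dotM mul_mx_scalar scalerA.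
  have -> : c * dot w v = 1.
    have ww : dot w w = 2 * dot w v.
      by rewrite /w !dot_lin v1 e1 (dotC v e); ring.
    rewrite /c ww; field.
    by apply/eqP => wv0; move: w0; rewrite ww wv0 mulr0 ltxx.
  by rewrite scale1r subKr.
Qed.

Lemma sym_deflation n (Q : 'M[R]_(1 + n)) a : Q^T = Q ->
  Q *m delta_mx 0 0 = a *: (delta_mx 0 0 : 'cV[R]_(1 + n)) ->
  Q = block_mx a%:M 0 0 (drsubmx Q).
Proof.
move=> Qt Qe.
have Qc i : Q i 0 = a * (i == 0)%:R.
  have := congr1 (fun M : 'cV[R]_(1 + n) => M i 0) Qe.
  by rewrite -colE !mxE andbT.
have ul : ulsubmx Q = a%:M.
  apply/matrixP => i j; rewrite !ord1 !mxE.
  transitivity (Q 0 0); first by congr (Q _ _); apply: val_inj.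
  by rewrite Qc eqxx mulr1 mulr1n.
have dl : dlsubmx Q = 0.
  apply/matrixP => i j; rewrite !ord1 !mxE.
  transitivity (Q (rshift 1 i) 0); first by congr (Q _ _); apply: val_inj.
  by rewrite Qc -val_eqE /= mulr0.
have ur : ursubmx Q = 0.
  by rewrite -(trmxK (ursubmx Q)) trmx_ursub Qt dl trmx0.
by rewrite -{1}(submxK Q) ul ur dl.
Qed.

Lemma block_diagonalization n (U : 'M[R]_n) s a : U *m U^T = 1%:M ->
  exists (V : 'M[R]_(1 + n)) t, V *m V^T = 1%:M /\
    block_mx a%:M 0 0 (U^T *m diag_mx s *m U) = V^T *m diag_mx t *m V.
Proof.
move=> UU; exists (block_mx 1%:M 0 0 U), (row_mx a%:M s).
rewrite diag_mx_row tr_block_mx !mulmx_block.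
rewrite !trmx0 trmx1 UU !mulmx0 !mul0mx !mulmx1 !mul1mx !addr0 !add0r.
split; first by rewrite -scalar_mx_block.
congr block_mx; last by rewrite mul0mx.
by apply/matrixP => i j; rewrite !ord1 !mxE.
Qed.

(** Induction on the size: a reflection carries a unit eigenvector to the first basis vector, and
    symmetry then splits off a 1 x 1 block. *)
Lemma sym_diagonalization n (P : 'M[R]_n) : P^T = P ->
  exists (U : 'M[R]_n) (s : 'rV[R]_n),
    U *m U^T = 1%:M /\ P = U^T *m diag_mx s *m U.
Proof.
elim: n P => [|n IH] P sP.
  by exists 1%:M, 0; split; [rewrite trmx1 mulmx1|apply/matrixP => -[]].
have [a [v [v1 Pv]]] := sym_real_eigenvector sP.
pose e : 'cV[R]_n.+1 := delta_mx 0 0.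
have e1 : dot e e = 1.
  by rewrite dot_trace /e trmx_delta mul_delta_mx /mxtrace big_ord1 mxE !eqxx.
have [H [Ht HH Hv]] := householder v1 e1.
have He : H *m e = v by rewrite -Hv mulmxA HH mul1mx.
pose Q := H *m P *m H.
have Qt : Q^T = Q by rewrite /Q !trmx_mul Ht sP mulmxA.
have Qe : Q *m e = a *: e by rewrite /Q -!mulmxA He Pv -scalemxAr Hv.
(* The same matrix, retyped so that block operations apply. *)
pose Q' : 'M[R]_(1 + n) := Q.
have Qb : Q' = block_mx a%:M 0 0 (drsubmx Q') by exact: sym_deflation.
have [|U [s [UU Ps]]] := IH (drsubmx Q').
  by rewrite trmx_drsub; congr drsubmx.
have [V [t [VV Qs]]] := block_diagonalization s a UU.
exists (V *m H), t; split.
  by rewrite trmx_mul Ht -mulmxA (mulmxA H) HH mul1mx.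
have -> : P = H *m Q *m H.
  by rewrite /Q !mulmxA HH mul1mx -mulmxA HH mulmx1.
have -> : Q = Q' by [].
by rewrite Qb Ps Qs trmx_mul Ht !mulmxA.
Qed.

Lemma orthoC n (U : 'M[R]_n) : U *m U^T = 1%:M -> U^T *m U = 1%:M.
Proof. exact: mulmx1C. Qed.

Lemma char_poly_diagonalized n (U : 'M[R]_n) (s : 'rV[R]_n) :
  U *m U^T = 1%:M ->
  char_poly (U^T *m diag_mx s *m U) = \prod_(i < n) ('X - (s 0 i)%:P).
Proof.
move=> UU; have UU' := orthoC UU.
have <- : char_poly (diag_mx s) = \prod_(i < n) ('X - (s 0 i)%:P).
  rewrite char_poly_trig ?diag_mx_is_trig//.
  by apply: eq_bigr => i _; rewrite mxE eqxx mulr1n.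
rewrite /char_poly /char_poly_mx !map_mxM /=.
set V := map_mx polyC U; have -> : map_mx polyC U^T = V^T by rewrite map_trmx.
have VV : V^T *m V = 1%:M by rewrite /V map_trmx -map_mxM UU' map_mx1.
have {1}-> : 'X%:M = V^T *m 'X%:M *m V.
  by rewrite mul_mx_scalar -scalemxAl VV scalemx1.
rewrite -mulmxBl -mulmxBr !det_mulmx mulrC mulrA -det_mulmx.
by rewrite (mulmx1C VV) det1 mul1r.
Qed.

(** [eigenvalues] is chosen from the characteristic polynomial alone. Unique factorization makes it
    a permutation of any diagonal form, and permuting the rows of [U] accordingly ties it to an
    orthonormal eigenbasis. *)
Lemma spectral_sorted n (P : 'M[R]_n) : P^T = P ->
  exists U : 'M[R]_n,
    [/\ U *m U^T = 1%:M,
        P = U^T *m diag_mx (\row_i eigval i.+1 P) *m U &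
        forall i j : 'I_n, (i <= j)%N -> eigval i.+1 P <= eigval j.+1 P].
Proof.
move=> /sym_diagonalization[U [s [UU Ps]]].
pose t := [seq s 0 i | i : 'I_n].
have tE : char_poly P = \prod_(a <- t) ('X - a%:P).
  by rewrite Ps char_poly_diagonalized// /t big_image.
have [so ch] : sorted <=%R (eigenvalues P) /\
    char_poly P = \prod_(a <- eigenvalues P) ('X - a%:P).
  apply: (@xgetPex _ [::] [set s | sorted <=%R s /\
     char_poly P = \prod_(a <- s) ('X - a%:P)]).
  exists (sort <=%R t); split; first exact: sort_le_sorted.
  by rewrite tE; apply: perm_big; rewrite perm_sym perm_sort.
have pe : perm_eq (eigenvalues P) t by apply: prod_XsubC_eq; rewrite -ch.
have sz : size (eigenvalues P) = n by rewrite (perm_size pe) size_image card_ord.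
have [p pE] : exists p : {perm 'I_n},
    eigenvalues P = [tuple tnth [tuple s 0 i | i < n] (p i) | i < n].
  by apply/tuple_permP; rewrite (perm_trans pe)//.
have ev (i : 'I_n) : eigval i.+1 P = s 0 (p i).
  rewrite /eigval pE /= (nth_map i) ?size_enum_ord// nth_ord_enum.
  by rewrite tnth_mktuple.
exists (row_perm p U); split.
- apply/matrixP => i j; rewrite !mxE.
  have := congr1 (fun M : 'M[R]_n => M (p i) (p j)) UU; rewrite !mxE.
  rewrite (inj_eq perm_inj) => <-.
  by apply: eq_bigr => k _; rewrite !mxE.
- rewrite [LHS]Ps -!mulmxA !mul_diag_mx; apply/matrixP => i j; rewrite !mxE.
  rewrite (reindex_inj (@perm_inj _ p)) /=; apply: eq_bigr => k _.
  by rewrite !mxE ev.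
- move=> i j ij; rewrite /eigval /=.
  by apply: le_sorted_leq_nth => //; rewrite inE sz ltn_ord.
Qed.

End Spectral.

(** * Quadratic forms in an orthonormal eigenbasis *)

Section Quadratic_forms.
Context {R : realType}.

(** Spectral calculus: functions of one symmetric matrix share [U], so their products become
    entrywise products of [s]. *)
Definition conj_diag n (U : 'M[R]_n) (s : 'rV[R]_n) : 'M[R]_n :=
  U^T *m diag_mx s *m U.

Lemma conj_diag_tr n (U : 'M[R]_n) s : (conj_diag U s)^T = conj_diag U s.
Proof. by rewrite /conj_diag !trmx_mul trmxK tr_diag_mx mulmxA. Qed.

Lemma conj_diagM n (U : 'M[R]_n) s t : U *m U^T = 1%:M ->
  conj_diag U s *m conj_diag U t = conj_diag U (\row_i (s 0 i * t 0 i)).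
Proof.
move=> UU; rewrite /conj_diag -!mulmxA; congr (_ *m _).
rewrite (mulmxA U) UU mul1mx !mulmxA; congr (_ *m _).
rewrite mulmx_diag.
by congr diag_mx; apply/rowP => i; rewrite !mxE.
Qed.

Lemma conj_diag1 n (U : 'M[R]_n) : U *m U^T = 1%:M ->
  conj_diag U (const_mx 1) = 1%:M.
Proof. by move=> UU; rewrite /conj_diag diag_const_mx mulmx1 orthoC. Qed.

Lemma conj_diag_quad n d (U : 'M[R]_n) s (X : 'M[R]_(n, d)) :
  dot X (conj_diag U s *m X) =
  \sum_i s 0 i * dot (row i (U *m X)) (row i (U *m X)).
Proof.
rewrite /conj_diag -!mulmxA -dot_mulmx mul_diag_mx dot_rows; apply: eq_bigr => i _.
rewrite -dotZr; congr dot.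
by apply/rowP => j; rewrite !mxE.
Qed.

Lemma dot_orthogonal n d (U : 'M[R]_n) (X : 'M[R]_(n, d)) : U *m U^T = 1%:M ->
  dot X X = \sum_i dot (row i (U *m X)) (row i (U *m X)).
Proof. by move=> UU; rewrite -dot_rows dot_mulmx mulmxA orthoC// mul1mx. Qed.

Variable (n : nat) (P : 'M[R]_n).
Hypothesis Ps : P^T = P.

Lemma eigval_attained (i : 'I_n) :
  exists2 v : 'cV[R]_n, dot v v = 1 & P *m v = eigval i.+1 P *: v.
Proof.
have [U [UU PE _]] := spectral_sorted Ps.
exists (U^T *m delta_mx i 0).
  rewrite dot_mulmx mulmxA trmxK UU mul1mx dot_trace trmx_delta mul_delta_mx.
  by rewrite /mxtrace big_ord1 mxE !eqxx.
rewrite {1}PE -!mulmxA (mulmxA U) UU mul1mx scalemxAr; congr (_ *m _).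
rewrite mul_diag_mx; apply/matrixP => k j; rewrite !mxE.
by case: eqP => [->//|_]; rewrite !mulr0.
Qed.

Lemma eigval_bounds (i : 'I_n) :
  lambda_min P <= eigval i.+1 P <= lambda_max P.
Proof.
have [U [UU PE mono]] := spectral_sorted Ps.
have n0 : (0 < n)%N by rewrite (leq_ltn_trans _ (ltn_ord i)).
have n1 : (n.-1 < n)%N by rewrite prednK.
have lo := mono (Ordinal n0) i (leq0n i).
have := mono i (Ordinal n1); rewrite /= -ltnS prednK// => /(_ (ltn_ord i)) hi.
by apply/andP.
Qed.

Lemma rayleigh d (X : 'M[R]_(n, d)) :
  lambda_min P * dot X X <= dot X (P *m X) <= lambda_max P * dot X X.
Proof.
have [U [UU PE mono]] := spectral_sorted Ps.
have -> : dot X (P *m X) =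
    \sum_(i < n) eigval i.+1 P * dot (row i (U *m X)) (row i (U *m X)).
  rewrite {1}PE conj_diag_quad; apply: eq_bigr => i _; rewrite mxE//.
rewrite (dot_orthogonal _ UU) !mulr_sumr; apply/andP; split;
  apply: ler_sum => i _; rewrite ler_wpM2r ?dot_ge0//.
  by have /andP[] := eigval_bounds i.
by have /andP[] := eigval_bounds i.
Qed.

Lemma lambda_min_attained : (0 < n)%N ->
  exists2 v : 'cV[R]_n, dot v v = 1 & P *m v = lambda_min P *: v.
Proof. by move=> n0; exact: (eigval_attained (Ordinal n0)). Qed.

Lemma lambda_max_attained : (0 < n)%N ->
  exists2 v : 'cV[R]_n, dot v v = 1 & P *m v = lambda_max P *: v.
Proof.
move=> n0; have n1 : (n.-1 < n)%N by rewrite prednK.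
have := eigval_attained (Ordinal n1).
by rewrite /= prednK.
Qed.

Lemma lambda_min_le_max : (0 < n)%N -> lambda_min P <= lambda_max P.
Proof.
move=> /lambda_max_attained[v v1 Pv].
by have /andP[+ _] := rayleigh v; rewrite Pv dotZr v1 !mulr1.
Qed.

(** In the eigenbasis each row is scaled by an eigenvalue minus [c], and the distance to [c] over an
    interval is largest at an endpoint. *)
Lemma shift_norm_le d (X : 'M[R]_(n, d)) (c : R) :
  frob (P *m X - c *: X) <=
  Num.max `|lambda_min P - c| `|lambda_max P - c| * frob X.
Proof.
have [U [UU PE mono]] := spectral_sorted Ps.
set K := Num.max _ _.
have K0 : 0 <= K by rewrite le_max normr_ge0.
rewrite -(ler_pXn2r (n:=2)) ?nnegrE ?frob_ge0 ?mulr_ge0 ?frob_ge0//.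
rewrite exprMn !frob_sqr !(dot_orthogonal _ UU) mulr_sumr.
apply: ler_sum => i _.
have -> : row i (U *m (P *m X - c *: X)) = (eigval i.+1 P - c) *: row i (U *m X).
  rewrite mulmxBr {1}PE -!mulmxA !mulmxA UU mul1mx -!mulmxA mul_diag_mx.
  by apply/rowP => j; rewrite -scalemxAr !mxE mulrBl.
rewrite !dot_lin mulrA -expr2; rewrite ler_wpM2r ?dot_ge0//.
rewrite -(real_normK (num_real (_ - c))) ler_pXn2r ?nnegrE//.
have /andP[lo hi] := eigval_bounds i.
rewrite /K le_max; have [c0|c0] := leP 0 (eigval i.+1 P - c).
  by apply/orP; right; rewrite (ger0_norm c0) ger0_norm; lra.
by apply/orP; left; rewrite (ltr0_norm c0) ler0_norm; lra.
Qed.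

End Quadratic_forms.

(** * Mixing matrices *)

Section Mixing.
Context {R : realType}.

Lemma invmx_comm n (P Q : 'M[R]_n) : Q \in unitmx -> P *m Q = Q *m P ->
  P *m invmx Q = invmx Q *m P.
Proof.
move=> Qu PQ; rewrite -[LHS]mul1mx -(mulVmx Qu) -mulmxA (mulmxA Q).
by rewrite -PQ -mulmxA mulmxV// mulmx1.
Qed.

Variables (m : nat) (C : 'M[R]_m).
Hypothesis hm : (1 < m)%N.
Hypothesis Cs : C^T = C.
Hypothesis Cge0 : forall v : 'cV[R]_m, 0 <= dot v (C *m v).
Hypothesis Clt1 : forall v : 'cV[R]_m, v != 0 -> 0 < dot v ((1%:M - C) *m v).
Hypothesis nullC :
  forall v : 'cV[R]_m, C *m v = 0 <-> exists a : R, v = a *: ones m.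

Let m_gt0 : (0 < m)%N := ltnW hm.

Lemma ones_neq0 : ones m != 0 :> 'cV[R]_m.
Proof.
apply/eqP => /matrixP/(_ (Ordinal m_gt0) 0) /eqP.
by rewrite !mxE oner_eq0.
Qed.

Lemma mul_ones_eq0 : C *m ones m = 0.
Proof. by apply/nullC; exists 1; rewrite scale1r. Qed.

Lemma unit_vec_neq0 n (v : 'cV[R]_n) : dot v v = 1 -> v != 0.
Proof. by apply: contra_eq_neq => ->; rewrite dot0l eq_sym oner_eq0. Qed.

Lemma eigval_lt1 (i : 'I_m) : eigval i.+1 C < 1.
Proof.
have [v v1 Cv] := eigval_attained Cs i.
by have := Clt1 (unit_vec_neq0 v1); rewrite mulmxBl mul1mx Cv !dot_lin v1; lra.
Qed.

Lemma eigval_ge0 (i : 'I_m) : 0 <= eigval i.+1 C.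
Proof.
have [v v1 Cv] := eigval_attained Cs i.
by have := Cge0 v; rewrite Cv dotZr v1 mulr1.
Qed.

Lemma eigval1_eq0 : eigval 1 C = 0.
Proof.
apply/eqP; rewrite eq_le (eigval_ge0 (Ordinal m_gt0)) andbT.
have /andP[+ _] := rayleigh Cs (ones m).
by rewrite mul_ones_eq0 dotC dot0l pmulr_lle0// dot_gt0// ones_neq0.
Qed.

(** Otherwise two orthonormal eigenvectors would lie in the kernel, both of them multiples of
    [ones]. *)
Lemma eigval2_gt0 : 0 < eigval 2 C.
Proof.
rewrite lt_neqAle (eigval_ge0 (Ordinal hm)) andbT eq_sym; apply/eqP => c2.
have [U [UU CE mono]] := spectral_sorted Cs.
have ker (i : 'I_m) : eigval i.+1 C = 0 -> C *m (U^T *m delta_mx i 0 : 'cV_m) = 0.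
  move=> ci; rewrite {1}CE -!mulmxA (mulmxA U) UU mul1mx mul_diag_mx.
  rewrite -[RHS](mulmx0 _ (U^T)); congr (_ *m _); apply/matrixP => k j; rewrite !mxE.
  by case: eqP => [->|_]; rewrite ?ci ?mul0r ?mulr0.
have /nullC[a ua] := ker (Ordinal m_gt0) eigval1_eq0.
have /nullC[b ub] := ker (Ordinal hm) c2.
have od (i j : 'I_m) :
    dot (U^T *m delta_mx i 0 : 'cV_m) (U^T *m delta_mx j 0) = (i == j)%:R.
  rewrite dot_mulmx mulmxA trmxK UU mul1mx dot_trace trmx_delta.
  rewrite /mxtrace big_ord1 mul_delta_mx_cond.
  by case: eqP => _; rewrite ?mulr1n ?mulr0n !mxE ?eqxx.
have := od (Ordinal m_gt0) (Ordinal hm); have := od (Ordinal hm) (Ordinal hm).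
have := od (Ordinal m_gt0) (Ordinal m_gt0).
rewrite ua ub !dot_lin !eqxx /=.
have := dot_gt0 ones_neq0; set o := dot _ _ => o0 aa bb ab.
have a0 : a != 0 by apply: contra_eq_neq aa => ->; rewrite mul0r eq_sym oner_eq0.
have b0 : b != 0 by apply: contra_eq_neq bb => ->; rewrite mul0r eq_sym oner_eq0.
move/eqP: ab; rewrite !mulf_eq0 (negPf a0) (negPf b0) /=.
by rewrite (gt_eqF o0).
Qed.

Lemma subC_diag : exists U : 'M[R]_m,
  [/\ U *m U^T = 1%:M, C = conj_diag U (\row_i eigval i.+1 C),
      1%:M - C \in unitmx &
      invmx (1%:M - C) = conj_diag U (\row_i (1 - eigval i.+1 C)^-1)].
Proof.
have [U [UU CE _]] := spectral_sorted Cs.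
pose M := conj_diag U (\row_i (1 - eigval i.+1 C)^-1).
have MC : (1%:M - C) *m M = 1%:M.
  rewrite mulmxBl mul1mx {1}CE -/(conj_diag _ _) conj_diagM//.
  rewrite /M /conj_diag -mulmxBl -mulmxBr -linearB /=.
  rewrite -[RHS](conj_diag1 UU); congr (_ *m diag_mx _ *m _).
  apply/rowP => i; rewrite !mxE -{1}[_^-1]mul1r -mulrBl divff//.
  by rewrite gt_eqF// subr_gt0 eigval_lt1.
have Su : 1%:M - C \in unitmx by case/mulmx1_unit: MC.
exists U; split=> //.
by have := congr1 (mulmx (invmx (1%:M - C))) MC; rewrite mulKmx// mulmx1 => <-.
Qed.

Let M := invmx (1%:M - C).

Lemma subC_unit : 1%:M - C \in unitmx.
Proof. by have [U []] := subC_diag. Qed.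

Lemma resolvent_tr : M^T = M.
Proof. by have [U [_ _ _]] := subC_diag; rewrite -/M => ->; rewrite conj_diag_tr. Qed.

Lemma resolvent_quad_ge0 d (X : 'M[R]_(m, d)) : 0 <= dot X (C *m M *m X).
Proof.
have [U [UU CE _ ME]] := subC_diag.
rewrite /M ME {1}CE conj_diagM// conj_diag_quad; apply: sumr_ge0 => i _.
rewrite mulr_ge0 ?dot_ge0// !mxE divr_ge0 ?eigval_ge0//.
by rewrite subr_ge0 ltW ?eigval_lt1.
Qed.

Lemma eigval2_le (i : 'I_m) : eigval i.+1 C = 0 \/ eigval 2 C <= eigval i.+1 C.
Proof.
have [U [_ _ mono]] := spectral_sorted Cs.
case: i => -[|i] im; first by left; exact: eigval1_eq0.
by right; apply: (mono (Ordinal hm) (Ordinal im)).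
Qed.

(** For an eigenvalue c of [C] this reads c <= (1 - c2) c / (1 - c): trivial at c = 0, and 1 - c <=
    1 - c2 for all others. The weight [C] kills the consensus direction, which is why the second
    eigenvalue governs the rate. *)
Lemma dual_contraction d (W : 'M[R]_(m, d)) :
  dot W (C *m W) <= (1 - eigval 2 C) * dot W (C *m M *m W).
Proof.
have [U [UU CE _ ME]] := subC_diag.
rewrite /M ME {1 3}CE conj_diagM// !conj_diag_quad mulr_sumr.
apply: ler_sum => i _; rewrite mulrA ler_wpM2r ?dot_ge0// !mxE.
have := eigval_lt1 i; have := eigval_ge0 i; have := eigval2_le i.
set c := eigval i.+1 C => -[->|c2] c0 c1; first by rewrite mul0r mulr0.
rewrite mulrA ler_pdivlMr ?subr_gt0// mulrC ler_wpM2r//; lra.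
Qed.

Lemma resolvent_quad_gt0 (v : 'cV[R]_m) : v != 0 -> 0 < dot v (M *m v).
Proof.
move=> v0; have v' : v = (1%:M - C) *m (M *m v).
  by rewrite mulKVmx ?subC_unit.
rewrite {1}v' dotC; apply: Clt1.
by apply: contra_neq v0 => Mv; rewrite v' Mv mulmx0.
Qed.

Variable B : 'M[R]_m.
Hypothesis Bs : B^T = B.
Hypothesis B1 : (ones m)^T *m B = (ones m)^T.
Hypothesis BC : B *m C = C *m B.

Lemma mul_ones_fixed : B *m ones m = ones m.
Proof. by rewrite -[LHS]trmxK trmx_mul Bs B1 trmxK. Qed.

Lemma resolvent_comm_mix : B *m M = M *m B.
Proof.
by apply: invmx_comm subC_unit _; rewrite mulmxBr mulmxBl mulmx1 mul1mx BC.
Qed.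

(** Commutation gives symmetry, so [lambda_BC] is a true largest eigenvalue and not the default
    value of [eigenvalues]. *)
Lemma coupling_tr : (B *m B *m M)^T = B *m B *m M.
Proof.
rewrite !trmx_mul Bs resolvent_tr mulmxA -resolvent_comm_mix -!mulmxA.
by rewrite resolvent_comm_mix.
Qed.

Lemma coupling_quad_le d (X : 'M[R]_(m, d)) :
  dot (B *m X) (M *m (B *m X)) <= lambda_BC B C * dot X X.
Proof.
have /andP[_] := rayleigh coupling_tr X; apply: le_trans.
by rewrite dot_mulmx Bs !mulmxA -(mulmxA B M) -resolvent_comm_mix mulmxA.
Qed.

(** [B] and [M] both fix [ones], so 1 is an eigenvalue. This makes the square root in the step-size
    bounds positive. *)
Lemma lambda_BC_ge1 : 1 <= lambda_BC B C.
Proof.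
have /andP[_] := rayleigh coupling_tr (ones m).
have M1 : M *m ones m = ones m.
  rewrite -{1}[ones m](_ : (1%:M - C) *m ones m = _).
    by rewrite mulmxA mulVmx ?subC_unit// mul1mx.
  by rewrite mulmxBl mul1mx mul_ones_eq0 subr0.
have -> : B *m B *m M *m ones m = ones m by rewrite -!mulmxA M1 !mul_ones_fixed.
by rewrite -{1}[dot _ _]mul1r ler_pM2r// dot_gt0// ones_neq0.
Qed.

Lemma lambda_BC_lt (k : R) :
  (forall v : 'cV[R]_m, v != 0 ->
    0 < dot v ((k *: (1%:M - C) - B *m B) *m v)) -> lambda_BC B C < k.
Proof.
move=> kP; have [v v1 Sv] := lambda_max_attained coupling_tr m_gt0.
have v0 := unit_vec_neq0 v1; have vMv := resolvent_quad_gt0 v0.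
have Mv0 : M *m v != 0.
  by apply: contra_neq v0 => Mv; rewrite -(mulKVmx subC_unit v) Mv mulmx0.
(* Tested at [M *m v], with [v] a top eigenvector of B^2 M, the form equals (k - lambda_BC) <v, M
   v>. *)
have := kP _ Mv0; rewrite mulmxBl -scalemxAl mulmxA mulmxV ?subC_unit// mul1mx.
rewrite mulmxA Sv -scalerBl dotZr dotC pmulr_lgt0// subr_gt0.
by [].
Qed.

End Mixing.

(** * Smooth strongly convex functions *)

Section Smooth_convex.
Context {R : realType}.

(** Bounds along a segment hold only for [t] in (0, 1), so the derivative is taken as a right limit
    of difference quotients, where the contribution [t * E] vanishes. *)
Lemma derive_le (g : R -> R) (D K E : R) : is_derive (0 : R) (1 : R) g D ->
  (forall t, 0 < t < 1 -> g t - g 0 <= t * K + t ^+ 2 * E) -> D <= K.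
Proof.
move=> [gd <-] gE.
have c1 : (fun h => h^-1 *: (g (h *: (1 : R) + 0) - g 0)) @ 0^'+ --> 'D_1 g 0.
  apply: cvg_trans gd; apply: cvg_app; apply: within_subset => h /=.
  by move=> h0; rewrite gt_eqF.
have c2 : (fun h : R => K + h * E) @ 0^'+ --> K.
  apply: cvg_at_right_filter.
  rewrite -[X in _ --> X](_ : K + 0 * E = K); last by rewrite mul0r addr0.
  by apply: cvgD; [exact: cvg_cst|apply: cvgM; [exact: cvg_id|exact: cvg_cst]].
apply: ler_cvg_to c1 c2 _.
near=> h.
have h0 : 0 < h by near: h; exact: nbhs_right_gt.
have h1 : h < 1 by near: h; apply: nbhs_right_lt.
rewrite addr0 /GRing.scale /= mulr1 mulrC ler_pdivrMr//.
have := gE h; rewrite h0 h1 => /(_ isT); lra.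
Unshelve. all: by end_near.
Qed.

Variable d : nat.
Implicit Types (f : 'rV[R]_d -> R) (x y v : 'rV[R]_d).

Lemma derive_grad f x v : differentiable f x -> 'D_v f x = dot (grad f x) v.
Proof.
move=> fx; rewrite deriveE// {1}[v]row_sum_delta linear_sum /= dotE big_ord1.
apply: eq_bigr => j _; rewrite linearZ /= -deriveE// mxE mulrC.
by [].
Qed.

Lemma is_derive_line f x v t : differentiable f (x + t *: v) ->
  is_derive t (1 : R) (fun s => f (x + s *: v)) (dot (grad f (x + t *: v)) v).
Proof.
move=> fx; have := derive_grad v fx; have := diff_derivable (v:=v) fx.
rewrite /derivable /derive => fd fe.
have E : (fun h => h^-1 *: (f (x + (h *: (1 : R) + t) *: v) - f (x + t *: v)))
    = (fun h => h^-1 *: (f (h *: v + (x + t *: v)) - f (x + t *: v))).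
  apply/funext => h; congr (_ *: (f _ - _)).
  by rewrite [h *: 1]mulr1 scalerDl addrCA.
by split; rewrite /derivable /derive /= E.
Qed.

Lemma strongly_convex_ge mu f x y : strongly_convex mu f -> differentiable f x ->
  f x + dot (grad f x) (y - x) + mu / 2 * dot (y - x) (y - x) <= f y.
Proof.
move=> fsc fx.
have fd : is_derive (0 : R) (1 : R) (fun s => f (x + s *: (y - x)))
    (dot (grad f x) (y - x)).
  by have := @is_derive_line f x (y - x) 0; rewrite scale0r addr0; apply.
suff : dot (grad f x) (y - x) <= f y - f x - mu / 2 * dot (y - x) (y - x) by lra.
(* The term - mu/2 t (1 - t) of strong convexity splits into a linear part, which stays in the
   bound, and a quadratic part, which is [E]. *)
apply: (derive_le (E := mu / 2 * dot (y - x) (y - x)) fd) => t /andP[t0 t1].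
have tt : 0 <= t <= 1 by rewrite !ltW.
have := fsc y x t tt.
rewrite frob_sqr scale0r addr0.
have -> : t *: y + (1 - t) *: x = x + t *: (y - x).
  by rewrite scalerBl scale1r scalerBr addrCA.
set q := dot _ _; lra.
Qed.

(** Descent lemma: the mean value theorem is applied to [f] along the segment minus its quadratic
    model, whose derivative is nonpositive by Cauchy-Schwarz and the Lipschitz bound. *)
Lemma smooth_le L f x y : smooth L f ->
  f y <= f x + dot (grad f x) (y - x) + L / 2 * dot (y - x) (y - x).
Proof.
move=> [fd fL]; have := subrKC x y; move: (y - x) => v xyE.
pose g t := f (x + t *: v) - (t * dot (grad f x) v + t ^+ 2 * (L / 2 * dot v v)).
pose dg t := dot (grad f (x + t *: v)) v -
   (dot (grad f x) v + 2 * t * (L / 2 * dot v v)).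
have gd t : is_derive t (1 : R) g (dg t).
  have h := @is_derive_line f x v t (fd _).
  rewrite /g; apply: is_derive_eq.
  by rewrite /dg /GRing.scale /=; ring.
have [|xi] := @MVT R g dg 0 1 ltr01 (fun t _ => gd t).
  apply: continuous_subspaceT => t.
  by apply: differentiable_continuous; apply/derivable1_diffP; have [] := gd t.
rewrite in_itv /= => /andP[xi0 _].
rewrite subr0 mulr1 {1 2}/g scale1r scale0r addr0 expr0n /= mul0r mul0r.
rewrite xyE.
suff : dg xi <= 0 by lra.
rewrite /dg.
have := cauchy_schwarz (grad f (x + xi *: v) - grad f x) v.
have xv : x + xi *: v - x = xi *: v by rewrite addrC addKr.
have := fL (x + xi *: v) x; rewrite xv frobZ ?(ltW xi0)//.
have := frob_ge0 v; rewrite !dot_lin -(frob_sqr v).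
set a := frob v => a0 h1 h2.
have := ler_wpM2r a0 h1; lra.
Qed.

(* A slack M >= L - mu is allowed because 1 / (L - mu) is junk when L = mu; that
   case of cocoercivity is obtained by letting M tend to 0. *)
Lemma smooth_convex_lower mu L M f x y : 0 < M -> L - mu <= M ->
  strongly_convex mu f -> smooth L f ->
  f x + dot (grad f x) (y - x) + mu / 2 * dot (y - x) (y - x) +
    M^-1 / 2 * dot (grad f y - grad f x - mu *: (y - x))
                   (grad f y - grad f x - mu *: (y - x)) <= f y.
Proof.
move=> M0 LM fsc fsm.
set e := grad f y - grad f x - mu *: (y - x).
(* For M = L - mu > 0 this point minimizes the smooth upper model at [y] minus the strongly convex
   lower model at [x]. *)
pose z := y - M^-1 *: e.
have := strongly_convex_ge z fsc (fsm.1 x); have := smooth_le y z fsm.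
have -> : z - y = - (M^-1 *: e) by rewrite /z addrC addKr.
have -> : z - x = (y - x) - M^-1 *: e by rewrite /z addrAC.
have : dot e e = dot (grad f y) e - dot (grad f x) e - mu * dot (y - x) e.
  by rewrite {1}/e !(dotBl, dotZl).
have := dot_ge0 e.
clearbody e; move: (y - x) => v.
rewrite !dot_lin !(dotC e v).
set ee := dot e e; set ve := dot v e; set vv := dot v v.
set gy := dot (grad f y) e; set gx := dot (grad f x) e; set gv := dot (grad f x) v.
move=> ee0 eE.
set k := M^-1; have k0 : 0 < k by rewrite invr_gt0.
have kM : k * (L - mu) <= 1.
  by rewrite -(mulVf (lt0r_neq0 M0)) ler_pM2l.
have := mulr_ge0 (mulr_ge0 (ltW k0) ee0) (_ : 0 <= 1 - k * (L - mu)).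
rewrite subr_ge0 => /(_ kM).
have := congr1 (fun z => k * z) eE => /= h.
lra.
Qed.

(** Adding the lower bounds for (x, y) and (y, x) cancels the function values. *)
Lemma cocoercive mu L f x y : mu <= L -> strongly_convex mu f -> smooth L f ->
  dot (grad f x - grad f y - mu *: (x - y)) (grad f x - grad f y - mu *: (x - y))
  <= (L - mu) * dot (grad f x - grad f y - mu *: (x - y)) (x - y).
Proof.
move=> muL fsc fsm.
set e := _ - mu *: _; set v := x - y.
have H M : 0 < M -> L - mu <= M -> dot e e <= M * dot e v.
  move=> M0 LM.
  have := smooth_convex_lower x y M0 LM fsc fsm.
  have := smooth_convex_lower y x M0 LM fsc fsm.
  have -> : grad f y - grad f x - mu *: (y - x) = - e.
    by rewrite /e opprB addrC -scalerN opprB opprB.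
  rewrite -/e -/v -(opprB x y) -/v !dotNl !dotNr !opprK.
  have : dot e v = dot (grad f x) v - dot (grad f y) v - mu * dot v v.
    by rewrite {1}/e (dotBl _ (mu *: _)) dotBl dotZl.
  move=> -> h1 h2.
  by rewrite -ler_pdivrMl//; lra.
have [Lmu|Lmu] := ltP 0 (L - mu); first exact: H.
have L0 : L - mu = 0 by lra.
rewrite L0 mul0r.
have ev : 0 <= dot e v.
  have := H 1 ltr01; rewrite L0 ler01 mul1r => /(_ isT); apply: le_trans.
  exact: dot_ge0.
apply/ler_addgt0Pr => eps eps0; rewrite add0r.
have e1 : 0 < 1 + dot e v by lra.
(* With this slack the bound [M * dot e v] is at most [eps]; the 1 keeps the denominator
   positive. *)
have := H (eps / (1 + dot e v)) (divr_gt0 eps0 e1).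
rewrite L0 ltW ?divr_gt0// => /(_ isT)/le_trans; apply.
rewrite mulrAC ler_pdivrMr// ler_pM2l//; lra.
Qed.

(** Cocoercivity with the square completed: both say |g|^2 - (L + mu) <g, v> + L mu |v|^2 <= 0. *)
Lemma grad_shift_le mu L f x y : mu <= L -> strongly_convex mu f -> smooth L f ->
  frob (grad f x - grad f y - ((L + mu) / 2) *: (x - y)) <=
  (L - mu) / 2 * frob (x - y).
Proof.
move=> muL fsc fsm.
have r0 : 0 <= (L - mu) / 2 by lra.
rewrite -(ler_pXn2r (n:=2)) ?nnegrE ?(mulr_ge0 r0) ?frob_ge0//.
rewrite exprMn !frob_sqr; have := cocoercive x y muL fsc fsm.
move: (x - y) (grad f x - grad f y) => v g.
rewrite !dot_lin !(dotC v g); lra.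
Qed.

Lemma grad_rows_shift_le m mu L (f : 'I_m -> 'rV[R]_d -> R) (X Y : 'M[R]_(m, d)) :
  mu <= L -> (forall i, strongly_convex mu (f i)) -> (forall i, smooth L (f i)) ->
  frob (grad_rows f X - grad_rows f Y - ((L + mu) / 2) *: (X - Y)) <=
  (L - mu) / 2 * frob (X - Y).
Proof.
move=> muL fsc fsm.
have r0 : 0 <= (L - mu) / 2 by lra.
rewrite -(ler_pXn2r (n:=2)) ?nnegrE ?(mulr_ge0 r0) ?frob_ge0//.
rewrite exprMn !frob_sqr !dot_rows mulr_sumr; apply: ler_sum => i _.
rewrite -!frob_sqr -exprMn ler_pXn2r ?nnegrE ?(mulr_ge0 r0) ?frob_ge0//.
have -> : row i (X - Y) = row i X - row i Y by apply/rowP => j; rewrite !mxE.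
have -> : row i (grad_rows f X - grad_rows f Y - ((L + mu) / 2) *: (X - Y)) =
    grad (f i) (row i X) - grad (f i) (row i Y)
    - ((L + mu) / 2) *: (row i X - row i Y) by apply/rowP => j; rewrite !mxE.
exact: grad_shift_le.
Qed.

End Smooth_convex.

(** * Optimality and proximal operators *)

Section Proximal.
Context {R : realType} (d : nat).
Implicit Types (G : 'rV[R]_d -> \bar R) (x y s : 'rV[R]_d).

Lemma coef_ge0 (a b : R) :
  (forall t, 0 < t < 1 -> 0 <= t * a + t ^+ 2 * b) -> 0 <= a.
Proof.
move=> h; apply: (derive_le (g := cst 0) (E := b) (is_derive_cst _ _ _)) => t /h.
by rewrite /= subrr.
Qed.

Lemma convex_fun_fin G x y (a b t : R) : convex_fun G -> 0 < t < 1 ->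
  G x = a%:E -> G y = b%:E ->
  (G (x + t *: (y - x))%R <= (a + t * (b - a))%:E)%E.
Proof.
move=> Gc /andP[t0 t1] Gx Gy; have tt : 0 <= t <= 1 by rewrite !ltW.
have := Gc y x t tt; rewrite Gx Gy.
have -> : t *: y + (1 - t) *: x = x + t *: (y - x).
  by rewrite scalerBl scale1r scalerBr addrCA.
move=> /le_trans; apply; rewrite -!EFinM -EFinD lee_fin; lra.
Qed.

Lemma ones_mulE m x i : row i (ones m *m x : 'M[R]_(m, d)) = x.
Proof. by apply/rowP => j; rewrite !mxE big_ord1 mxE mul1r. Qed.

(** Fermat's rule. Along a segment the smooth part exceeds its linearization by at most O(t^2), so
    only first-order terms survive in [coef_ge0]. *)
Lemma minimizer_subgradient m (L : R) (f : 'I_m -> 'rV[R]_d -> R) G xstar :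
  (forall i, smooth L (f i)) -> proper_fun G -> convex_fun G ->
  argmin (fun x => ((m%:R^-1 * \sum_(i < m) f i x)%:E + G x)%E) xstar ->
  exists2 a, G xstar = a%:E & forall y b, G y = b%:E ->
    a + dot (- (m%:R^-1 *: \sum_i grad (f i) xstar)) (y - xstar) <= b.
Proof.
move=> fsm [GN [x0 Gx0]] Gc xmin.
have [a Ga] : exists a, G xstar = a%:E.
  have := xmin x0; move: (GN x0) Gx0 (GN xstar).
  by case: (G x0) => // b _ _; case: (G xstar) => // a _ _; exists a.
exists a => // y b Gy.
set v := y - xstar; set gF := m%:R^-1 *: _.
suff : 0 <= b - a + dot gF v by rewrite dotNl; lra.
(* The product [m%:R^-1 * m%:R] is left as it is, since it equals 0 when [m] is 0. *)
apply: (@coef_ge0 _ (L / 2 * dot v v * (m%:R^-1 * m%:R))) => t t01.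
have tG := convex_fun_fin Gc t01 Ga Gy.
have := xmin (xstar + t *: v).
move: tG (GN (xstar + t *: v)); rewrite Ga.
case: (G _) => // c; rewrite lee_fin => ca _.
rewrite -!EFinD lee_fin => FF.
have : m%:R^-1 * \sum_(i < m) f i (xstar + t *: v) <=
  m%:R^-1 * \sum_(i < m) (f i xstar + t * dot (grad (f i) xstar) v +
                          t ^+ 2 * (L / 2 * dot v v)).
  rewrite ler_wpM2l ?invr_ge0//; apply: ler_sum => i _.
  apply: le_trans (smooth_le xstar (xstar + t *: v) (fsm i)) _.
  rewrite (addrC xstar) addrK !dotZr dotZl; lra.
rewrite !big_split /= sumr_const card_ord -mulr_sumr -(mulr_natr (t ^+ 2 * _)).
have -> : \sum_(i < m) dot (grad (f i) xstar) v = dot (\sum_i grad (f i) xstar) v.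
  elim/big_ind2: _ => [|x1 x2 y1 y2 -> ->|//]; first by rewrite dot0l.
  by rewrite dotDl.
rewrite /gF dotZl.
move: FF; move: (dot _ v) (m%:R^-1) (\sum_(i < m) f i xstar) (\sum_(i < m) f i (_ + _)).
move=> S mi F0 F1 FF FL.
have -> : t * (b - a + mi * S) + t ^+ 2 * (L / 2 * dot v v * (mi * m%:R)) =
  (t * (b - a)) + (mi * (F0 + t * S + t ^+ 2 * (L / 2 * dot v v) * m%:R) - mi * F0).
  by ring.
lra.
Qed.

(* As s is a subgradient of G at xstar, the right-hand side compares Z with a point
   whose image under the proximal operator is 1 xstar^T. *)
Lemma prox_nonexpansive_at m gamma G xstar s (a : R) (X Z : 'M[R]_(m, d)) :
  0 < gamma -> (forall x, G x != -oo%E) -> convex_fun G ->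
  G xstar = a%:E ->
  (forall y b, G y = b%:E -> a + dot s (y - xstar) <= b) ->
  prox gamma (sum_rows G) Z X ->
  frob (X - ones m *m xstar) <=
  frob (Z - (ones m *m xstar + gamma *: (ones m *m s))).
Proof.
move=> gamma0 GN Gc Ga Gs ZX; set Xs := ones m *m xstar.
pose c := (2 * gamma)^-1; have c0 : 0 < c by rewrite invr_gt0; lra.
have GXs : sum_rows G Xs = (\sum_(i < m) a)%:E.
  by rewrite /sum_rows -sumEFin; apply: eq_bigr => i _; rewrite ones_mulE.
(* The finite value at [Xs] rules out +oo at the minimizer; as -oo never occurs, every row has a
   finite value. *)
have GXfin i : exists b, G (row i X) = b%:E.
  have : sum_rows G X != +oo%E.
    have := ZX Xs; rewrite GXs -EFinD => h; apply/eqP => XE; move: h.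
    by rewrite XE.
  move: (GN (row i X)); case E : (G (row i X)) => [b| |]// _; first by exists b.
  rewrite /sum_rows esum_eqy// => /existsPn/(_ i).
  by rewrite E eqxx.
have [b Gb] := choice GXfin.
have GX : sum_rows G X = (\sum_(i < m) b i)%:E.
  by rewrite /sum_rows -sumEFin; apply: eq_bigr.
set V := Xs - X.
(* Variational inequality of the proximal problem, from moving [X] slightly towards [Xs]. *)
have step : 0 <= \sum_(i < m) (a - b i) - 2 * c * dot (Z - X) V.
  apply: (@coef_ge0 _ (c * dot V V)) => t t01.
  have := ZX (X + t *: V); rewrite GX.
  have GXt : (sum_rows G (X + t *: V)%R <=
      (\sum_(i < m) (b i + t * (a - b i))%R)%R%:E)%E.
    rewrite /sum_rows -sumEFin; apply: lee_sum => i _.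
    have -> : row i (X + t *: V) = row i X + t *: (xstar - row i X).
      by rewrite -(ones_mulE xstar i); apply/rowP => j; rewrite !mxE.
    exact: convex_fun_fin.
  move=> /le_trans/(_ (leeD2r _ GXt)); rewrite -!EFinD lee_fin big_split /=.
  rewrite -mulr_sumr !frob_sqr opprD addrA !(dotBl _ (t *: V)) !(dotBr _ (t *: V)).
  rewrite !dotZl !dotZr !(dotC V (Z - X)) -/c; lra.
have sub : \sum_(i < m) (a - b i) <= dot (ones m *m s) V.
  rewrite dot_rows; apply: ler_sum => i _; rewrite ones_mulE.
  have -> : row i V = - (row i X - xstar).
    by rewrite -(ones_mulE xstar i); apply/rowP => j; rewrite !mxE opprB.
  by rewrite dotNr; have := Gs _ _ (Gb i); lra.
set x := X - Xs; set z := Z - _.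
(* Firm nonexpansiveness: [step] and [sub] combine into <Z - X - gamma 1 s, x> >= 0. *)
have zx : dot x x <= dot z x.
  have -> : z = x + (Z - X - gamma *: (ones m *m s)).
    have aux (p q r t : 'M[R]_(m, d)) : p - (q + t) = r - q + (p - r - t).
      by apply/matrixP => i j; rewrite !mxE; ring.
    exact: aux.
  have Vx : V = - x by rewrite /x opprB.
  rewrite dotDl lerDl dotBl dotZl.
  move: step sub; rewrite Vx !dotNr.
  have cg : 2 * c * gamma = 1 by rewrite /c; field; rewrite gt_eqF.
  set p := dot (Z - X) x; set q := dot _ x; set S := \sum_i _ => h1 h2.
  have h3 : 0 <= gamma * (S + 2 * c * p) by rewrite mulr_ge0 ?(ltW gamma0)//; lra.
  have h4 : gamma * S <= gamma * (- q) by rewrite ler_pM2l.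
  have : gamma * (2 * c * p) = p by rewrite mulrA (mulrC gamma) cg mul1r.
  lra.
have := le_trans zx (cauchy_schwarz z x).
rewrite -frob_sqr expr2; have := frob_ge0 x; rewrite le_eqVlt => /orP[/eqP <- _|x0].
  exact: frob_ge0.
by rewrite ler_pM2r.
Qed.

End Proximal.

(** * Convergence of the iterates *)

Section Consensus.
Context {R : realType}.

(** At v - t P v the form is - 2 t |P v|^2 + O(t^2), which is nonnegative for small t only if P v =
    0. *)
Lemma psd_quad_eq0 n (P : 'M[R]_n) (v : 'cV[R]_n) : P^T = P ->
  (forall u : 'cV[R]_n, 0 <= dot u (P *m u)) -> dot v (P *m v) = 0 -> P *m v = 0.
Proof.
move=> Ps Pge0 Pv0; set p := P *m v.
suff : 0 <= - 2 * dot p p.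
  by move=> h; apply: dot_eq0; have := dot_ge0 p; lra.
apply: (@coef_ge0 _ _ (dot p (P *m p))) => t _.
have := Pge0 (v - t *: p).
rewrite mulmxBr -scalemxAr -/p !dot_lin.
have -> : dot v (P *m p) = dot p p by rewrite -{1}Ps -dot_mulmx.
rewrite Pv0; lra.
Qed.

(** The range of a symmetric matrix is the orthogonal complement of its kernel: the columns of the
    cokernel of [C] are multiples of [ones], which [Y^T] annihilates. *)
Lemma consensus_range m d (C : 'M[R]_m) (Y : 'M[R]_(m, d)) : C^T = C ->
  (forall v : 'cV[R]_m, C *m v = 0 -> exists a : R, v = a *: ones m) ->
  (ones m)^T *m Y = 0 -> exists W, Y = C *m W.
Proof.
move=> Cs nullC Y0.
have : (Y^T <= C)%MS.
  rewrite submxE; have := mulmx_coker C; move: (cokermx C) => K CK.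
  apply/eqP/matrixP => i j.
  have [a ja] : exists a, col j K = a *: ones m.
    by apply: nullC; rewrite colE mulmxA CK mul0mx.
  transitivity ((Y^T *m col j K) i 0).
    by rewrite colE mulmxA -colE [RHS]mxE.
  have YT : Y^T *m ones m = 0 by rewrite -[LHS]trmxK trmx_mul trmxK Y0 trmx0.
  by rewrite ja -scalemxAr YT scaler0 !mxE.
by move=> /submxP[W YE]; exists W^T; rewrite -[LHS]trmxK YE trmx_mul Cs.
Qed.

(* The weights are chosen so that the cross terms between a and C W cancel. *)
Lemma lyapunov_identity m d (C : 'M[R]_m) (a W : 'M[R]_(m, d)) :
  C^T = C -> 1%:M - C \in unitmx ->
  let M := invmx (1%:M - C) in let z := a - C *m W in
  dot z z + dot (W + z) (C *m M *m (W + z)) =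
  dot a (M *m a) + dot W (C *m W).
Proof.
move=> Cs Su M z.
have MS : M *m (1%:M - C) = 1%:M by exact: mulVmx.
have MC : M *m C = M - 1%:M.
  by rewrite -MS mulmxBr mulmx1 opprB addrC subrK.
have CM : C *m M = M - 1%:M.
  have := mulmxV Su; rewrite -/M mulmxBl mul1mx => <-.
  by rewrite opprB addrC subrK.
have wE : W + z = a + (1%:M - C) *m W.
  by rewrite /z mulmxBl mul1mx addrCA.
have -> : C *m M *m (W + z) = C *m M *m a + C *m W.
  rewrite wE mulmxDr mulmxA; congr (_ + _ *m _).
  by rewrite -mulmxA MS mulmx1.
rewrite wE /z.
(* Because (I - C) C M = C, both cross terms of the weighted form equal <a, C W>, against - 2 <a, C
   W> in <z, z>. *)
have SCM : dot ((1%:M - C) *m W) (C *m M *m a) = dot (C *m W) a.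
  rewrite dot_mulmx linearB /= trmx1 Cs.
  have -> : (1%:M - C) *m (C *m M *m a) = C *m a.
    rewrite CM !mulmxA mulmxBr mulmx1 mulmxV//.
    by rewrite opprB addrC subrK.
  by rewrite [RHS]dot_mulmx Cs.
have -> : M *m a = C *m M *m a + a.
  by rewrite CM mulmxBl mul1mx subrK.
rewrite !dot_lin SCM mulmxBl mul1mx !dotBl.
rewrite (dotC a (C *m W)); ring.
Qed.

(** For a <= b the larger of |a| and |b| is b or -a, and adding r gives b + r or -(a - r), the
    shifted endpoints. The triangle inequality thus costs nothing. *)
Lemma qfactor_bound (lmin lmax gamma mu L : R) : lmin <= lmax -> 0 < gamma ->
  mu <= L ->
  Num.max `|lmin - gamma * ((L + mu) / 2)| `|lmax - gamma * ((L + mu) / 2)| +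
  gamma * ((L - mu) / 2) <= Num.max `|lmin - gamma * L| `|lmax - gamma * mu|.
Proof.
move=> ll g0 muL; rewrite -lerBrDr ge_max; set r := gamma * ((L - mu) / 2).
have r0 : 0 <= r by rewrite mulr_ge0 ?(ltW g0)//; lra.
have -> : lmin - gamma * L = lmin - gamma * ((L + mu) / 2) - r by rewrite /r; field.
have -> : lmax - gamma * mu = lmax - gamma * ((L + mu) / 2) + r by rewrite /r; field.
have : lmin - gamma * ((L + mu) / 2) <= lmax - gamma * ((L + mu) / 2) by lra.
move: (lmin - _) (lmax - _) => a b ab.
have A1 : a + r <= Num.max `|a - r| `|b + r|.
  by rewrite le_max; apply/orP; right; have := ler_norm (b + r); lra.
have A2 : - a + r <= Num.max `|a - r| `|b + r|.
  rewrite le_max; apply/orP; left; have := ler_norm (- (a - r)).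
  by rewrite normrN; lra.
have A3 : b + r <= Num.max `|a - r| `|b + r|.
  by rewrite le_max; apply/orP; right; have := ler_norm (b + r); lra.
have A4 : - b + r <= Num.max `|a - r| `|b + r|.
  rewrite le_max; apply/orP; left; have := ler_norm (- (a - r)).
  by rewrite normrN; lra.
by apply/andP; split; rewrite ler_norml; apply/andP; split; lra.
Qed.

(** [D] and the gradient increment are each compared with a multiple of [X - Xs], chosen so that
    these multiples cancel. *)
Lemma gradient_step_le m d (mu L gamma : R) (f : 'I_m -> 'rV[R]_d -> R)
    (D : 'M[R]_m) (X Xs : 'M[R]_(m, d)) :
  (0 < m)%N -> 0 < gamma -> mu <= L -> D^T = D ->
  (forall i, strongly_convex mu (f i)) -> (forall i, smooth L (f i)) ->
  frob (D *m (X - Xs) - gamma *: (grad_rows f X - grad_rows f Xs)) <=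
  qfactor mu L D gamma * frob (X - Xs).
Proof.
move=> m0 g0 muL Ds fsc fsm.
set x := X - Xs; set g := grad_rows f X - _.
have -> : D *m x - gamma *: g =
    (D *m x - (gamma * ((L + mu) / 2)) *: x) - gamma *: (g - ((L + mu) / 2) *: x).
  by rewrite (scalerBr gamma g) scalerA opprB addrA subrK.
apply: le_trans (frob_triangle _ _) _; rewrite frobN frobZ ?(ltW g0)//.
have h1 := shift_norm_le Ds x (gamma * ((L + mu) / 2)).
have h2 := grad_rows_shift_le X Xs muL fsc fsm.
have h3 := qfactor_bound (lambda_min_le_max Ds m0) g0 muL.
apply: (le_trans _ (ler_wpM2r (frob_ge0 x) h3)).
by rewrite [leRHS]mulrDl lerD// -[leRHS]mulrA ler_wpM2l// ltW.
Qed.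

End Consensus.

(** * Fixed point and contraction of the Lyapunov function *)

Section Convergence.
Context {R : realType} (m d : nat).
Variables (B C D : 'M[R]_m).
Hypothesis hm : (1 < m)%N.
Hypothesis Cs : C^T = C.
Hypothesis Cge0 : forall v : 'cV[R]_m, 0 <= dot v (C *m v).
Hypothesis Clt1 : forall v : 'cV[R]_m, v != 0 -> 0 < dot v ((1%:M - C) *m v).
Hypothesis nullC :
  forall v : 'cV[R]_m, C *m v = 0 <-> exists a : R, v = a *: ones m.
Hypothesis Bs : B^T = B.
Hypothesis B1 : (ones m)^T *m B = (ones m)^T.
Hypothesis BC : B *m C = C *m B.

Let m_gt0 : (0 < m)%N := ltnW hm.

Definition lyapunov (z W : 'M[R]_(m, d)) : R :=
  dot z z + dot W (C *m invmx (1%:M - C) *m W).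

Lemma lyapunov_step (q : R) (z x u W : 'M[R]_(m, d)) : 0 <= q ->
  frob u <= q * frob x -> frob x <= frob z ->
  lyapunov (B *m u - C *m W) (W + (B *m u - C *m W)) <=
  Num.max (q ^+ 2 * lambda_BC B C) (1 - eigval 2 C) * lyapunov z W.
Proof.
move=> q0 ux xz; rewrite /lyapunov.
rewrite lyapunov_identity ?subC_unit//.
have Bu := coupling_quad_le Cs Clt1 Bs BC u.
have CW := dual_contraction hm Cs Cge0 Clt1 nullC W.
have CMW := resolvent_quad_ge0 Cs Cge0 Clt1 W.
rewrite mulrDr; apply: lerD; last first.
  by apply: le_trans CW _; rewrite ler_wpM2r// le_max lexx orbT.
apply: le_trans Bu _.
have uz : dot u u <= q ^+ 2 * dot z z.
  rewrite -!frob_sqr -exprMn ler_pXn2r ?nnegrE ?frob_ge0 ?(mulr_ge0 q0) ?frob_ge0//.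
  by apply: le_trans ux _; rewrite ler_wpM2l.
have l0 : 0 <= lambda_BC B C.
  by apply: le_trans ler01 _; exact: (lambda_BC_ge1 hm Cs Clt1 nullC).
apply: le_trans (ler_wpM2l l0 uz) _.
by rewrite mulrA (mulrC (lambda_BC B C)) ler_wpM2r ?dot_ge0// le_max lexx.
Qed.

Variables (mu L gamma : R) (f : 'I_m -> 'rV[R]_d -> R) (G : 'rV[R]_d -> \bar R).
Variable xstar : 'rV[R]_d.
Hypothesis muL : mu <= L.
Hypothesis gamma_gt0 : 0 < gamma.
Hypothesis fsc : forall i, strongly_convex mu (f i).
Hypothesis fsm : forall i, smooth L (f i).
Hypothesis Gproper : proper_fun G.
Hypothesis Gconvex : convex_fun G.
Hypothesis xmin : argmin
  (fun x => ((m%:R^-1 * \sum_(i < m) f i x)%:E + G x)%E) xstar.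
Hypothesis Ds : D^T = D.
Hypothesis D1 : D *m ones m = ones m.

Lemma iterates_bound (X Z Y : nat -> 'M[R]_(m, d)) :
  abc_iterates (B *m D) B C gamma f G X Z Y ->
  exists V, forall k,
    frob (X k - ones m *m xstar) ^+ 2 <= rate mu L B C D gamma ^+ k * V.
Proof.
move=> [Y0 XZ ZS YS].
have [a Ga Gsub] := minimizer_subgradient fsm Gproper Gconvex xmin.
set s := - _ in Gsub.
(* As [s] is a subgradient at [xstar], the proximal operator sends [Zs] to [Xs]; [Ys] then solves Zs
   = B D Xs - gamma B gs - Ys, where B D Xs = Xs. *)
pose Xs := ones m *m xstar; pose Zs := Xs + gamma *: (ones m *m s).
pose gs := grad_rows f Xs.
pose Ys := - (gamma *: (B *m gs + ones m *m s)).
have [W0 W0E] : exists W0, Y 0 = C *m W0.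
  have [w wE] := choice Y0; exists (\matrix_(i, j) w j i 0).
  apply/matrixP => i j; have := congr1 (fun M : 'cV_m => M i 0) (wE j).
  by rewrite !mxE => ->; apply: eq_bigr => k _; rewrite mxE.
(* The column sums of [Ys] vanish since [s] is minus the mean of the gradients at [xstar]. *)
have [Ws WsE] : exists Ws, Ys = C *m Ws.
  apply: consensus_range => //; first by move=> v /nullC.
  rewrite /Ys mulmxN -scalemxAr mulmxDr mulmxA B1 mulmxA.
  have -> : (ones m)^T *m ones m = m%:R%:M :> 'M[R]_1.
    apply/matrixP => i j; rewrite !ord1 !mxE mulr1n.
    under eq_bigr do rewrite !mxE mulr1.
    by rewrite sumr_const card_ord.
  rewrite mul_scalar_mx /s scalerN scalerA divff ?scale1r; last first.
    by rewrite pnatr_eq0 -lt0n.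
  have -> : (ones m)^T *m gs = \sum_i grad (f i) xstar.
    apply/rowP => j; rewrite mxE summxE; apply: eq_bigr => i _.
    by rewrite !mxE mul1r ones_mulE.
  by rewrite subrr scaler0 oppr0.
pose delta k := D *m (X k - Xs) - gamma *: (grad_rows f (X k) - gs).
(* A primal of the dual error: summing the increments of [Y] and using C Zs = 0 gives Y k - Ys = C W
   k. In the successor case [Z k] is the new iterate. *)
pose W := fix W k := if k is k'.+1 then W k' + (Z k - Zs) else W0 - Ws.
have CZs : C *m Zs = 0.
  rewrite /Zs mulmxDr -scalemxAr /Xs !mulmxA (mul_ones_eq0 nullC) !mul0mx.
  by rewrite scaler0 addr0.
have YW k : Y k = C *m W k + Ys.
  elim: k => [|k IH]; first by rewrite /= mulmxBr -W0E -WsE subrK.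
  by rewrite YS IH /= mulmxDr mulmxBr CZs subr0 addrAC.
have ZE k : Z k.+1 - Zs = B *m delta k - C *m W k.
  rewrite ZS YW /delta /Zs /Ys -/gs.
  have BXs : B *m (D *m Xs) = Xs.
    by rewrite /Xs (mulmxA D) D1 mulmxA (mul_ones_fixed Bs B1).
  rewrite !mulmxBr -!scalemxAr mulmxBr BXs -!mulmxA.
  have alg (p1 p2 p3 p4 p5 p6 : 'M[R]_(m, d)) :
    p1 - gamma *: p2 - (p3 - gamma *: (p4 + p5)) - (p6 + gamma *: p5) =
    p1 - p6 - gamma *: (p2 - p4) - p3 by apply/matrixP => i j; rewrite !mxE; ring.
  exact: alg.
have xz k : frob (X k - Xs) <= frob (Z k - Zs).
  exact: (prox_nonexpansive_at gamma_gt0 Gproper.1 Gconvex Ga Gsub (XZ k)).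
exists (lyapunov (Z 0 - Zs) (W 0)) => k.
have rate0 : 0 <= rate mu L B C D gamma.
  rewrite le_max mulr_ge0 ?sqr_ge0//.
  by apply: le_trans ler01 _; exact: (lambda_BC_ge1 hm Cs Clt1 nullC).
have q0 : 0 <= qfactor mu L D gamma by rewrite le_max normr_ge0.
have Vk : lyapunov (Z k - Zs) (W k) <=
    rate mu L B C D gamma ^+ k * lyapunov (Z 0 - Zs) (W 0).
  elim: k => [|k IH]; first by rewrite expr0 mul1r.
  rewrite exprS -mulrA; apply: le_trans (ler_wpM2l rate0 IH).
  rewrite [W _]/= ZE; apply: (lyapunov_step _ q0 _ (xz k)).
  exact: gradient_step_le.
apply: le_trans Vk; rewrite /lyapunov -frob_sqr.
have := resolvent_quad_ge0 Cs Cge0 Clt1 (W k).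
have : frob (X k - Xs) ^+ 2 <= frob (Z k - Zs) ^+ 2.
  by rewrite ler_pXn2r ?nnegrE ?frob_ge0.
rewrite -/Xs; lra.
Qed.

End Convergence.

(** * Step sizes *)

Section Step_size.
Context {R : realType}.

Lemma mixing_fixes_ones m (D : 'M[R]_m) : D^T = D ->
  (forall v : 'cV[R]_m, 0 <= dot v ((1%:M - D) *m v)) ->
  dot (ones m) (D *m ones m) = dot (ones m) (ones m) -> D *m ones m = ones m.
Proof.
move=> Ds Dle1 D1; apply/esym/eqP; rewrite -subr_eq0; apply/eqP.
rewrite -{1}[ones m]mul1mx -mulmxBl; apply: psd_quad_eq0 => //.
  by rewrite linearB /= trmx1 Ds.
by rewrite mulmxBl mul1mx dotBr D1 subrr.
Qed.

(** With s = lambda_BC^(-1/2) the window gives - s < lambda_min - gamma L and lambda_max - gamma mu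
    < s. The opposite halves follow from lambda_min - gamma L <= lambda_max - gamma mu. *)
Lemma rate_lt1 (m : nat) (mu L gamma : R) (B C D : 'M[R]_m) :
  0 < mu -> mu <= L -> lambda_min D <= lambda_max D -> 1 <= lambda_BC B C ->
  0 < eigval 2 C -> admissible_step mu L B C D gamma -> rate mu L B C D gamma < 1.
Proof.
move=> mu0 muL ll l1 c2 [g0 /andP[lo hi]].
have l0 : 0 < lambda_BC B C by lra.
have sl : 0 < Num.sqrt (lambda_BC B C) by rewrite sqrtr_gt0.
rewrite /rate gt_max; apply/andP; split; last by lra.
move: lo hi; set s := (Num.sqrt _)^-1 => lo hi.
have s0 : 0 < s by rewrite invr_gt0.
have qs : qfactor mu L D gamma < s.
  have hi' : L * gamma < lambda_min D + s.
    by move: hi; rewrite mulrC ltr_pdivlMr 1?mulrC//; lra.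
  have lo' : lambda_max D - s < mu * gamma.
    rewrite -ltr_pdivrMl//; apply: le_lt_trans lo.
    by rewrite ler_pM2l ?invr_gt0// le_max lexx.
  have gg : gamma * mu <= gamma * L by rewrite ler_pM2l.
  rewrite /qfactor gt_max !ltr_norml.
  by apply/andP; split; apply/andP; split; lra.
have q0 : 0 <= qfactor mu L D gamma by rewrite le_max normr_ge0.
have q2 : qfactor mu L D gamma ^+ 2 < s ^+ 2 by rewrite ltr_pXn2r ?nnegrE// ltW.
have : qfactor mu L D gamma ^+ 2 * lambda_BC B C < s ^+ 2 * lambda_BC B C.
  by rewrite ltr_pM2r.
by rewrite /s exprVn sqr_sqrtr ?(ltW l0)// mulVf ?gt_eqF.
Qed.

(** This step balances the maximum: the two arguments become opposite numbers. *)
Lemma qfactor_gamma_star m (mu L : R) (D : 'M[R]_m) : 0 < mu -> mu <= L ->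
  lambda_min D <= lambda_max D -> 0 <= lambda_max D ->
  qfactor mu L D (gamma_star mu L D) = q_star mu L D.
Proof.
move=> mu0 muL ll l0; rewrite /qfactor /gamma_star /q_star.
have Lm : L + mu != 0 by rewrite gt_eqF//; lra.
set a := lambda_min D; set b := lambda_max D.
have -> : a - (b + a) / (L + mu) * L = - ((L * b - mu * a) / (L + mu)) by field.
have -> : b - (b + a) / (L + mu) * mu = (L * b - mu * a) / (L + mu) by field.
rewrite normrN maxxx ger0_norm// divr_ge0//; last by lra.
have : mu * a <= mu * b by rewrite ler_pM2l.
have : mu * b <= L * b by rewrite ler_wpM2r.
lra.
Qed.

(** [q_star] is the average of gamma L - lambda_min and lambda_max - gamma mu with weights mu and L,
    in which gamma cancels. *)
Lemma q_star_le m (mu L gamma : R) (D : 'M[R]_m) : 0 < mu -> mu <= L ->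
  q_star mu L D <= qfactor mu L D gamma.
Proof.
move=> mu0 muL; rewrite /q_star ler_pdivrMr; last by lra.
rewrite /qfactor; set a := lambda_min D; set b := lambda_max D; set q := Num.max _ _.
have qa : - (a - gamma * L) <= q.
  by rewrite le_max (le_trans (ler_norm _))// normrN.
have qb : b - gamma * mu <= q by rewrite le_max ler_norm orbT.
have h1 : mu * (- (a - gamma * L)) <= mu * q by rewrite ler_pM2l.
have h2 : L * (b - gamma * mu) <= L * q by rewrite ler_wpM2l//; lra.
lra.
Qed.

(** At [gamma_star], q^* = 1 - mu gamma = L gamma - lambda_min, so both ends of the window amount to
    q^* < lambda_BC^(-1/2). Positivity of the step comes from lambda_min > -1. *)
Lemma gamma_star_admissible m (mu L : R) (B C D : 'M[R]_m) : 0 < mu -> mu <= L ->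
  lambda_max D = 1 -> -1 < lambda_min D <= 1 ->
  1 <= lambda_BC B C -> q_star mu L D ^+ 2 * lambda_BC B C < 1 ->
  admissible_step mu L B C D (gamma_star mu L D).
Proof.
move=> mu0 muL bE /andP[a1 a2] l1 ql.
have l0 : 0 < lambda_BC B C by lra.
have sl : 0 < Num.sqrt (lambda_BC B C) by rewrite sqrtr_gt0.
have Lm : 0 < L + mu by lra.
have qs : q_star mu L D < (Num.sqrt (lambda_BC B C))^-1.
  rewrite ltNge; apply/negP => sq.
  have : (Num.sqrt (lambda_BC B C))^-1 ^+ 2 * lambda_BC B C <=
      q_star mu L D ^+ 2 * lambda_BC B C.
    have s0 : 0 <= (Num.sqrt (lambda_BC B C))^-1 by rewrite invr_ge0 ltW.
    by rewrite ler_pM2r// ler_pXn2r ?nnegrE// (le_trans s0).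
  by rewrite exprVn sqr_sqrtr ?(ltW l0)// mulVf ?gt_eqF// leNgt ql.
move: qs; rewrite /admissible_step /q_star /gamma_star bE.
set s := (Num.sqrt _)^-1; set a := lambda_min D => qs.
have g0 : 0 < (1 + a) / (L + mu) by rewrite divr_gt0//; rewrite /a; lra.
split=> //.
have qE : (L * 1 - mu * a) / (L + mu) = 1 - mu * ((1 + a) / (L + mu)).
  by field; rewrite gt_eqF.
have qE' : (L * 1 - mu * a) / (L + mu) = L * ((1 + a) / (L + mu)) - a.
  by field; rewrite gt_eqF.
apply/andP; split.
  rewrite ltr_pdivrMl// gt_max; apply/andP; split; first by lra.
  by rewrite mulr_gt0.
by rewrite ltr_pdivlMl; lra.
Qed.

End Step_size.

Theorem theorem3 (R : realType) (m d : nat) (hm : (1 < m)%N) (mu L : R)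
  (hmu : 0 < mu) (hmuL : mu <= L)
  (f : 'I_m -> 'rV[R]_d -> R)
  (hf_sc : forall i, strongly_convex mu (f i))
  (hf_sm : forall i, smooth L (f i))
  (G : 'rV[R]_d -> \bar R)
  (hG_proper : proper_fun G) (hG_closed : closed_fun G)
  (hG_convex : convex_fun G)
  (xstar : 'rV[R]_d)
  (hxstar : argmin
     (fun x => ((m%:R^-1 * \sum_(i < m) f i x)%:E + G x)%E) xstar)
  (A B C D : 'M[R]_m)
  (hB : B \is symmetricmx) (hC : loewner_le 0 C)
  (ha : forall v : 'cV[R]_m, C *m v = 0 <-> exists a : R, v = a *: ones m)
  (hb1 : (ones m)^T *m A *m ones m = (m%:R)%:M)
  (hb2 : (ones m)^T *m B = (ones m)^T)
  (hc : A = B *m D) (hD : D \is symmetricmx)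
  (hD1 : loewner_lt (- 1%:M) D) (hD2 : loewner_le D 1%:M)
  (hd : loewner_lt 0 (1%:M - C))
  (he : B *m C = C *m B)
  (hf : coupling_condition mu L B C D) :
  (forall gamma : R, admissible_step mu L B C D gamma ->
     rate mu L B C D gamma < 1 /\
     forall X Z Y : nat -> 'M[R]_(m, d),
       abc_iterates A B C gamma f G X Z Y ->
       (fun k => frob (X k - ones m *m xstar) ^+ 2)
         =O_\oo (fun k => rate mu L B C D gamma ^+ k)) /\
  [/\ admissible_step mu L B C D (gamma_star mu L D),
      qfactor mu L D (gamma_star mu L D) = q_star mu L D,
      forall gamma : R,
        qfactor mu L D (gamma_star mu L D) <= qfactor mu L D gamma &
      forall gamma : R,
        rate mu L B C D (gamma_star mu L D) <= rate mu L B C D gamma].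
Proof.
have m0 : (0 < m)%N := ltnW hm.
move: hC => [/symmetricmx_trP Cs Cge]; rewrite subr0 in Cs Cge.
have Cge0 (v : 'cV[R]_m) : 0 <= dot v (C *m v) by rewrite -quadE.
have Clt1 (v : 'cV[R]_m) : v != 0 -> 0 < dot v ((1%:M - C) *m v).
  by move=> v0; have := hd.2 v v0; rewrite subr0 quadE.
have Bs := (symmetricmx_trP B).1 hB.
have Ds := (symmetricmx_trP D).1 hD.
have l1 := lambda_BC_ge1 hm Cs Clt1 ha Bs hb2 he.
have Dle1 (v : 'cV[R]_m) : 0 <= dot v ((1%:M - D) *m v) by rewrite -quadE; apply: hD2.2.
have o0 : 0 < dot (ones m) (ones m) :> R by rewrite dot_gt0// ones_neq0.
(* 1^T D 1 = 1^T B D 1 = 1^T A 1 = m, the equality case of D <= I. *)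
have D1 : D *m ones m = ones m.
  apply: mixing_fixes_ones => //.
  rewrite -quadE -[in LHS]hb2 -(mulmxA _ B) -hc hb1 dotE.
  rewrite mxE mulr1n; under eq_bigr do rewrite big_ord1 !mxE mulr1.
  by rewrite sumr_const card_ord.
have bE : lambda_max D = 1.
  apply/eqP; rewrite eq_le; apply/andP; split.
    have [v v1 Dv] := lambda_max_attained Ds m0.
    by have := Dle1 v; rewrite mulmxBl mul1mx Dv !dot_lin v1; lra.
  have /andP[_] := rayleigh Ds (ones m).
  by rewrite D1 -{1}[dot _ _]mul1r ler_pM2r.
have ll := lambda_min_le_max Ds m0.
have a1 : -1 < lambda_min D.
  have [v v1 Dv] := lambda_min_attained Ds m0.
  have := hD1.2 v (unit_vec_neq0 v1).
  by rewrite quadE opprK mulmxDl mul1mx Dv !dot_lin v1; lra.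
have c2 := eigval2_gt0 hm Cs Cge0 ha.
have qE : qfactor mu L D (gamma_star mu L D) = q_star mu L D.
  by apply: qfactor_gamma_star; rewrite // bE.
have qmin gamma : qfactor mu L D (gamma_star mu L D) <= qfactor mu L D gamma.
  by rewrite qE; apply: q_star_le.
split; last first.
  split=> //.
    apply: gamma_star_admissible => //; first by rewrite a1 -bE.
    (* An infinite coefficient means q^* = 0; otherwise (f) is exactly q^*^2 lambda_BC < 1. *)
    have [q0|q0] := eqVneq (L * lambda_max D - mu * lambda_min D) 0.
      by rewrite /q_star q0 mul0r expr0n mul0r ltr01.
    have Lm : L + mu != 0 by rewrite gt_eqF//; lra.
    have [_ hfP] := hf q0.
    have /(lambda_BC_lt hm Cs Clt1 Bs he) : forall v : 'cV[R]_m, v != 0 ->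
        0 < dot v (((L + mu) ^+ 2 / (L * lambda_max D - mu * lambda_min D) ^+ 2
                      *: (1%:M - C) - B *m B) *m v).
      by move=> v v0; rewrite -quadE; apply: hfP.
    rewrite ltr_pdivlMr ?exprn_even_gt0//.
    rewrite /q_star expr_div_n mulrAC ltr_pdivrMr ?exprn_even_gt0// mul1r.
    by rewrite mulrC.
  (* Only the first entry of the maximum depends on the step, and it increases with q. *)
  move=> gamma; rewrite /rate ge_max !le_max lexx orbT andbT.
  rewrite ler_wpM2r ?orTb//; first by lra.
  have q_ge0 g : 0 <= qfactor mu L D g by rewrite le_max normr_ge0.
  by rewrite ler_pXn2r ?nnegrE ?q_ge0.
move=> gamma adm; split; first exact: rate_lt1.
move=> X Z Y; rewrite hc => it.
have [V XV] := iterates_bound hm Cs Cge0 Clt1 ha Bs hb2 he hmuL adm.1 hf_sc hf_sm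
  hG_proper hG_convex hxstar Ds D1 it.
have r0 : 0 <= rate mu L B C D gamma.
  by rewrite le_max mulr_ge0 ?sqr_ge0//; lra.
apply/eqO_exP; exists (`|V| + 1); first by rewrite ltr_wpDl.
apply: nearW => k; have rk := exprn_ge0 k r0.
rewrite /= (ger0_norm rk) ger0_norm ?sqr_ge0//.
apply: le_trans (XV k) _; rewrite [leLHS]mulrC ler_wpM2r//.
by have := ler_norm V; lra.
Qed.
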